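(* Let $X\in\mathbb{R}^{m\times n}$ with $\operatorname{rank}(X)=r\le d$. Let $0<p\le 1$ and $p_1,p_2,p_3>0$ satisfy $1/p_1+1/p_2+1/p_3=1/p$. Then, with all minima taken over $U\in\mathbb{R}^{m\times d}$, $V\in\mathbb{R}^{d\times d}$, $W\in\mathbb{R}^{n\times d}$ with $X=UVW^{T}$ (and attained), \[ \|X\|_{S_p}=\min\|U\|_{S_{p_1}}\|V\|_{S_{p_2}}\|W\|_{S_{p_3}} =\min\left(\frac{p_2p_3\|U\|_{S_{p_1}}^{p_1}+p_1p_3\|V\|_{S_{p_2}}^{p_2}+p_1p_2\|W\|_{S_{p_3}}^{p_3}}{p_2p_3+p_1p_3+p_1p_2}\right)^{1/p} =\min\left(\frac{\|U\|_{S_{p_1}}^{p_1}/p_1+\|V\|_{S_{p_2}}^{p_2}/p_2+\|W\|_{S_{p_3}}^{p_3}/p_3}{1/p}\right)^{1/p}. \]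
   Context: For $0<q<\infty$ and a real matrix $Y$ with singular values $\sigma_1(Y),\dots,\sigma_k(Y)$ ($k$ the smaller dimension of $Y$), the Schatten-$q$ (quasi-)norm is $\|Y\|_{S_q}=\left(\sum_{i=1}^{k}\sigma_i(Y)^q\right)^{1/q}$. *)

(* Defs.v *)
From HB Require Import structures.
From mathcomp Require Import all_boot all_order all_algebra.
From mathcomp Require Import all_classical all_reals all_analysis.
Set Implicit Arguments. Unset Strict Implicit. Unset Printing Implicit Defensive.
Import Order.TTheory GRing.Theory Num.Theory.
Local Open Scope ring_scope.
Local Open Scope classical_set_scope.

Definition is_svals {R : realType} {m n : nat} (Y : 'M[R]_(m, n)) (s : nat -> R) :=
  (forall i, (i < minn m n)%N -> 0 <= s i) /\
  exists (P : 'M[R]_m) (Q : 'M[R]_n),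
    P *m P^T = 1%:M /\ Q *m Q^T = 1%:M /\
    Y = P *m (\matrix_(i < m, j < n) (if (i : nat) == j then s i else 0)) *m Q.

(* the singular values of Y (chosen; unique up to order) *)
Definition svals {R : realType} {m n : nat} (Y : 'M[R]_(m, n)) : nat -> R :=
  xget (fun=> 0) [set s | is_svals Y s].

Definition schatten {R : realType} {m n : nat} (q : R) (Y : 'M[R]_(m, n)) : R :=
  (\sum_(i < minn m n) (svals Y i) `^ q) `^ q^-1.

Definition factor_min {R : realType} {m n d : nat} (X : 'M[R]_(m, n))
  (f : 'M[R]_(m, d) -> 'M[R]_d -> 'M[R]_(n, d) -> R) (v : R) :=
  (exists U V W, X = U *m V *m W^T /\ f U V W = v) /\
  (forall U V W, X = U *m V *m W^T -> v <= f U V W).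

(* Main.v *)
(** Singular values of a product are log-majorized: if [C] has orthonormal rows
    and [E] orthonormal columns, [k] of each, then [|det (C A E)|] is at most the
    product of the [k] largest singular values of [A] (by Courant-Fischer), and
    this bound is multiplicative in [A] because [B E = F (F^T B E)] for some [F]
    with orthonormal columns. Hence the products of the first [k] singular values
    of [U V W^T] are dominated by those of [u_i v_i w_i] (Horn). Log-majorization
    passes to sums of [p]-th powers, and the three-term Hölder and Young
    inequalities give the lower bounds. They are attained by distributing the
    singular values [x_i] of [X = P diag(x) Q] over the three factors as
    [x_i^(p/p1)], [x_i^(p/p2)], [x_i^(p/p3)]. Singular values are obtained by
    maximizing [|xA|] over the unit sphere and deflating. *)
Require Import Defs.
From HB Require Import structures.
From mathcomp Require Import all_boot all_order all_algebra all_fingroup.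
From mathcomp Require Import all_classical all_reals all_analysis.
From mathcomp Require Import ring lra zify.
Set Implicit Arguments. Unset Strict Implicit. Unset Printing Implicit Defensive.
Import Order.TTheory GRing.Theory Num.Theory.
Import numFieldNormedType.Exports.
Local Open Scope ring_scope.

(** * Inequalities for finite sums *)

Section inequalities.
Variable R : realType.
Implicit Types (x y l : nat -> R).

Lemma le_1Dln (x : R) : 0 < x -> 1 + ln x <= x.
Proof. by move=> x0; rewrite -[leRHS]lnK ?posrE// expR_ge1Dx. Qed.

(** Weighted arithmetic-geometric mean inequality, from the tangent to the logarithm at the
    geometric mean [G]. If a variable vanishes, so does the left side. *)
Lemma young3 (al be ga a b c : R) : 0 < al -> 0 < be -> 0 < ga ->
  al + be + ga = 1 -> 0 <= a -> 0 <= b -> 0 <= c ->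
  a `^ al * b `^ be * c `^ ga <= al * a + be * b + ga * c.
Proof.
move=> al0 be0 ga0 sum1 a0 b0 c0.
have rhs0 : 0 <= al * a + be * b + ga * c.
  by rewrite !addr_ge0// mulr_ge0// ltW.
have [a_eq0|a_neq0] := eqVneq a 0.
  by rewrite {1}a_eq0 powR0 ?gt_eqF// !mul0r.
have [b_eq0|b_neq0] := eqVneq b 0.
  by rewrite {1}b_eq0 powR0 ?gt_eqF// mulr0 mul0r.
have [c_eq0|c_neq0] := eqVneq c 0.
  by rewrite {1}c_eq0 powR0 ?gt_eqF// mulr0.
have {}a0 : 0 < a by rewrite lt0r a_neq0.
have {}b0 : 0 < b by rewrite lt0r b_neq0.
have {}c0 : 0 < c by rewrite lt0r c_neq0.
set G := a `^ al * b `^ be * c `^ ga.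
have G0 : 0 < G by rewrite !mulr_gt0// powR_gt0.
have lnG : ln G = al * ln a + be * ln b + ga * ln c.
  by rewrite !lnM ?posrE ?mulr_gt0 ?powR_gt0// !ln_powR.
(* In the weighted sum of these bounds at [a], [b], [c] the logarithms cancel by [lnG], which leaves
   exactly [G]. *)
have tangent (t : R) : 0 < t -> G * (1 + (ln t - ln G)) <= t.
  move=> t0; rewrite -ln_div ?posrE// mulrC -ler_pdivlMr//.
  by rewrite le_1Dln// divr_gt0.
have ha : al * (G * (1 + (ln a - ln G))) <= al * a by rewrite ler_pM2l// tangent.
have hb : be * (G * (1 + (ln b - ln G))) <= be * b by rewrite ler_pM2l// tangent.
have hc : ga * (G * (1 + (ln c - ln G))) <= ga * c by rewrite ler_pM2l// tangent.
apply: le_trans (lerD (lerD ha hb) hc); rewrite le_eqVlt; apply/orP; left.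
apply/eqP; have -> : ga = 1 - al - be by rewrite -sum1; ring.
have := lnG; have -> : ga = 1 - al - be by rewrite -sum1; ring.
by move=> ->; ring.
Qed.

(** Each sequence is divided by its sum and [young3] is applied termwise; the bounds then add up to
    [al + be + ga = 1]. A zero sum forces all its terms, hence the left side, to vanish. *)
Lemma hoelder3 (al be ga : R) (N : nat) (a b c : nat -> R) :
  0 < al -> 0 < be -> 0 < ga -> al + be + ga = 1 ->
  (forall i, 0 <= a i) -> (forall i, 0 <= b i) -> (forall i, 0 <= c i) ->
  \sum_(i < N) (a i `^ al * b i `^ be * c i `^ ga) <=
  (\sum_(i < N) a i) `^ al * (\sum_(i < N) b i) `^ be * (\sum_(i < N) c i) `^ ga.
Proof.
move=> al0 be0 ga0 sum1 a0 b0 c0.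
have sum0 (e : nat -> R) : (forall i, 0 <= e i) -> \sum_(i < N) e i = 0 ->
    forall i : 'I_N, e i = 0.
  move=> e0 /eqP; rewrite psumr_eq0// => /allP h i.
  by apply/eqP; have := h i; rewrite mem_index_enum/=; apply.
have [A0|A_neq0] := eqVneq (\sum_(i < N) a i) 0.
  rewrite A0 big1 ?powR0 ?gt_eqF ?mul0r// => i _.
  by rewrite (sum0 _ a0 A0) powR0 ?gt_eqF// !mul0r.
have [B0|B_neq0] := eqVneq (\sum_(i < N) b i) 0.
  rewrite B0 big1 ?powR0 ?gt_eqF ?mulr0 ?mul0r// => i _.
  by rewrite (sum0 _ b0 B0) powR0 ?gt_eqF// mulr0 mul0r.
have [C0|C_neq0] := eqVneq (\sum_(i < N) c i) 0.
  rewrite C0 big1 ?[0 `^ _]powR0 ?gt_eqF ?mulr0// => i _.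
  by rewrite (sum0 _ c0 C0) [0 `^ _]powR0 ?gt_eqF// mulr0.
set A := \sum_(i < N) a i in A_neq0 *.
set B := \sum_(i < N) b i in B_neq0 *.
set C := \sum_(i < N) c i in C_neq0 *.
have A0 : 0 < A by rewrite lt0r A_neq0 sumr_ge0.
have B0 : 0 < B by rewrite lt0r B_neq0 sumr_ge0.
have C0 : 0 < C by rewrite lt0r C_neq0 sumr_ge0.
pose D := A `^ al * B `^ be * C `^ ga.
have D0 : 0 < D by rewrite !mulr_gt0// powR_gt0.
rewrite -/D -[leRHS]mul1r -ler_pdivrMr// mulr_suml.
apply: (@le_trans _ _
    (\sum_(i < N) (al * (a i / A) + be * (b i / B) + ga * (c i / C)))).
  apply: ler_sum => i _; apply: le_trans (young3 al0 be0 ga0 sum1 _ _ _); rewrite ?divr_ge0 ?(ltW A0) ?(ltW B0) ?(ltW C0)//.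
  rewrite le_eqVlt; apply/orP; left; apply/eqP.
  rewrite !powRM ?invr_ge0 ?(ltW A0) ?(ltW B0) ?(ltW C0)//.
  have inv (t e : R) : 0 < t -> t^-1 `^ e = (t `^ e)^-1.
    by move=> t0; rewrite -(powR_inv1 (ltW t0)) -powRrM mulN1r powRN.
  rewrite !inv// /D; field.
  by rewrite !gt_eqF ?powR_gt0.
rewrite !big_split/= -!mulr_sumr -!mulr_suml -/A -/B -/C !divff// !mulr1.
by rewrite sum1.
Qed.

(** Summation by parts as an induction: the partial sum of [l] is nonnegative, so its coefficient
    [x N] may be lowered to [x N.+1] before the next term is added. *)
Lemma abel_sum_ge x l N :
  (forall i, x i.+1 <= x i) ->
  (forall k, (k <= N.+1)%N -> 0 <= \sum_(i < k) l i) ->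
  x N * \sum_(i < N.+1) l i <= \sum_(i < N.+1) x i * l i.
Proof.
move=> x_dec; elim: N => [_|N IH L0]; first by rewrite !big_ord1.
rewrite [leRHS]big_ord_recr/= [X in _ * X]big_ord_recr/= mulrDr lerD2r.
apply: le_trans (IH _) => [|k kN]; last by apply: L0; lia.
by apply: ler_wpM2r => //; apply: L0.
Qed.

Lemma nonincreasing_le x i j : (forall i, x i.+1 <= x i) -> (i <= j)%N -> x j <= x i.
Proof.
move=> xd; elim: j => [|j IH]; first by rewrite leqn0 => /eqP ->.
rewrite leq_eqVlt ltnS => /predU1P[-> //|/IH]; exact: le_trans (xd _).
Qed.

(* Convexity of exp in the form [y - x >= x (ln y - ln x)], then summation by parts. *)
Lemma log_majorization_sum x y N :
  (forall i, 0 <= x i) -> (forall i, 0 <= y i) -> (forall i, x i.+1 <= x i) ->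
  (forall k, (k <= N)%N -> \prod_(i < k) x i <= \prod_(i < k) y i) ->
  \sum_(i < N) x i <= \sum_(i < N) y i.
Proof.
move=> x0 y0 x_dec; elim: N => [_|N IH maj]; first by rewrite !big_ord0.
(* A vanishing last term reduces to the induction hypothesis. Otherwise all [x i] are positive by
   monotonicity, all [y i] by the last product inequality, and logarithms can be taken. *)
have [xN|xN] := eqVneq (x N) 0.
  rewrite !big_ord_recr/= xN lerD// IH// => k kN; apply: maj; lia.
have xgt0 i : (i <= N)%N -> 0 < x i.
  by move=> iN; apply: lt_le_trans (nonincreasing_le x_dec iN); rewrite lt0r xN x0.
have px k : (k <= N.+1)%N -> 0 < \prod_(i < k) x i.
  by move=> kN; apply: prodr_gt0 => i _; apply: xgt0; have := ltn_ord i; lia.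
have ygt0 i : (i <= N)%N -> 0 < y i.
  move=> iN; rewrite lt0r y0 andbT; apply/eqP => yi0.
  have := lt_le_trans (px N.+1 (leqnn _)) (maj _ (leqnn _)).
  rewrite (bigD1 (Ordinal (iN : (i < N.+1)%N)))//= yi0 mul0r ltxx.
  by [].
have lnprod (z : nat -> R) k : (k <= N.+1)%N -> (forall i, (i <= N)%N -> 0 < z i) ->
    ln (\prod_(i < k) z i) = \sum_(i < k) ln (z i).
  move=> + z0; elim: k => [_|k IHk kN]; first by rewrite !big_ord0 ln1.
  rewrite !big_ord_recr/= lnM ?posrE ?IHk ?z0//; try lia.
  by apply: prodr_gt0 => i _; apply: z0; have := ltn_ord i; lia.
have L0 k : (k <= N.+1)%N -> 0 <= \sum_(i < k) (ln (y i) - ln (x i)).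
  move=> kN; rewrite sumrB -!lnprod// subr_ge0 ler_ln ?posrE ?maj ?px//.
  exact: lt_le_trans (px _ kN) (maj _ kN).
rewrite -subr_ge0 -sumrB.
apply: (@le_trans _ _ (\sum_(i < N.+1) x i * (ln (y i) - ln (x i)))).
  apply: le_trans (@abel_sum_ge x (fun i => ln (y i) - ln (x i)) N x_dec L0).
  by rewrite mulr_ge0 ?L0.
apply: ler_sum => i _; have iN : (i <= N)%N by rewrite -ltnS.
rewrite -ln_div ?posrE ?ygt0 ?xgt0//.
have := le_1Dln (divr_gt0 (ygt0 _ iN) (xgt0 _ iN)).
rewrite ler_pdivlMr ?xgt0// => h; lra.
Qed.
End inequalities.

(** * Rectangular diagonal matrices and orthogonal completion *)

Section rectangular_diagonal.
Variable R : realType.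

(** Spelled as the middle factor in [is_svals], so that folding it is a conversion; a diagonal
    indexed by [nat] fits every shape. *)
Definition rdiag m n (s : nat -> R) : 'M[R]_(m, n) :=
  \matrix_(i < m, j < n) (if (i : nat) == j then s i else 0).

Lemma eq_rdiag m n (s t : nat -> R) :
  (forall i, (i < minn m n)%N -> s i = t i) -> rdiag m n s = rdiag m n t.
Proof.
move=> st; apply/matrixP => i j; rewrite !mxE; case: eqP => // ij.
by apply: st; rewrite leq_min ltn_ord {1}ij ltn_ord.
Qed.

Lemma tr_rdiag m n s : (rdiag m n s)^T = rdiag n m s.
Proof. by apply/matrixP => i j; rewrite !mxE eq_sym; case: eqP => // ->. Qed.

Lemma rdiag1 n : rdiag n n (fun=> 1) = 1%:M.
Proof. by apply/matrixP => i j; rewrite !mxE -val_eqE/=; case: eqP. Qed.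

(** The inner dimension [n] cuts the diagonal off; the hypothesis says that nothing nonzero is
    lost. *)
Lemma mul_rdiag m n k (s t : nat -> R) :
  (forall i, (n <= i)%N -> s i * t i = 0) ->
  rdiag m n s *m rdiag n k t = rdiag m k (fun i => s i * t i).
Proof.
move=> st; apply/matrixP => i j; rewrite !mxE.
have [ni|ni] := leqP n i.
  rewrite big1 => [|h _]; last first.
    rewrite !mxE; case: eqP => [ih|]; last by rewrite mul0r.
    by have := ltn_ord h; rewrite -ih ltnNge ni.
  by case: eqP => // _; rewrite st.
rewrite (bigD1 (Ordinal ni))//= big1 => [|h]; last first.
  by rewrite !mxE -val_eqE/= eq_sym => /negPf ->; rewrite mul0r.
by rewrite !mxE /= eqxx addr0; case: eqP; rewrite // mulr0.
Qed.

Lemma det_rdiag k (s : nat -> R) : \det (rdiag k k s) = \prod_(i < k) s i.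
Proof.
have -> : rdiag k k s = diag_mx (\row_i s i).
  by apply/matrixP => i j; rewrite !mxE -val_eqE/=; case: eqP => ij; rewrite ?mulr1n ?mulr0n.
by rewrite det_diag; apply: eq_bigr => i _; rewrite mxE.
Qed.

End rectangular_diagonal.

(** * Squared Euclidean norm of row vectors *)

Section square_norm.
Variable R : realType.

Definition nsq n (x : 'rV[R]_n) : R := \sum_i x 0 i ^+ 2.

Lemma nsqE n (x : 'rV[R]_n) : nsq x = (x *m x^T) 0 0.
Proof. by rewrite mxE; apply: eq_bigr => i _; rewrite mxE expr2. Qed.

Lemma nsq_ge0 n (x : 'rV[R]_n) : 0 <= nsq x.
Proof. by apply: sumr_ge0 => i _; rewrite sqr_ge0. Qed.

Lemma nsq0 n : nsq (0 : 'rV[R]_n) = 0.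
Proof. by rewrite /nsq big1// => i _; rewrite mxE expr0n. Qed.

Lemma nsq_eq0 n (x : 'rV[R]_n) : nsq x = 0 -> x = 0.
Proof.
move=> /eqP; rewrite psumr_eq0 => [/allP h|i _]; last by rewrite sqr_ge0.
apply/rowP => i; rewrite mxE; have := h i; rewrite mem_index_enum/= sqrf_eq0.
by move=> /(_ isT)/eqP.
Qed.

Lemma nsqZ n a (x : 'rV[R]_n) : nsq (a *: x) = a ^+ 2 * nsq x.
Proof. by rewrite mulr_sumr; apply: eq_bigr => i _; rewrite mxE exprMn. Qed.

Lemma nsq_mul_isometry m n (x : 'rV[R]_m) (C : 'M[R]_(m, n)) :
  C *m C^T = 1%:M -> nsq (x *m C) = nsq x.
Proof. by move=> CC; rewrite !nsqE trmx_mul !mulmxA -(mulmxA x) CC mulmx1. Qed.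

Lemma nsq_row_mx n1 n2 (x : 'rV[R]_n1) (y : 'rV[R]_n2) :
  nsq (row_mx x y) = nsq x + nsq y.
Proof.
by rewrite /nsq big_split_ord/=; congr (_ + _); apply: eq_bigr => i _;
  rewrite ?row_mxEl ?row_mxEr.
Qed.

(** Pythagoras: [x *m E *m E^T] is an orthogonal projection of [x], and the residual has squared
    norm [nsq x - nsq (x *m E)]. *)
Lemma nsq_mul_contraction m n (x : 'rV[R]_m) (E : 'M[R]_(m, n)) :
  E^T *m E = 1%:M -> nsq (x *m E) <= nsq x.
Proof.
move=> EE; have := nsq_ge0 (x - x *m E *m E^T).
have -> : nsq (x - x *m E *m E^T) = nsq x - nsq (x *m E).
  rewrite !nsqE linearB/= mulmxBl !mulmxBr !trmx_mul trmxK !mulmxA.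
  by rewrite -(mulmxA _ E^T E) EE mulmx1 subrr subr0 !mxE.
by rewrite subr_ge0.
Qed.

Lemma continuous_nsq_mul m n (A : 'M[R]_(m, n)) :
  continuous (fun x : 'rV[R]_m => nsq (x *m A)).
Proof.
have sumC (I : Type) (r : seq I) (f : I -> 'rV[R]_m -> R) :
    (forall i, continuous (f i)) -> continuous (fun x => \sum_(i <- r) f i x).
  move=> fc; elim: r => [|i r IH] x.
    under [X in continuous_at _ X]eq_fun do rewrite big_nil.
    exact: cst_continuous.
  under [X in continuous_at _ X]eq_fun do rewrite big_cons.
  by apply: continuousD; [exact: fc|exact: IH].
have c j : continuous (fun x : 'rV[R]_m => (x *m A) 0 j).
  rewrite [X in continuous X](_ : _ = fun x : 'rV[R]_m => \sum_i x 0 i * A i j).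
    apply: sumC => i y; apply: continuousM.
      exact: coord_continuous.
    exact: cst_continuous.
  by apply/funext => x; rewrite mxE.
apply: sumC => j x.
rewrite [X in continuous_at _ X](_ : _ = fun x : 'rV[R]_m => (x *m A) 0 j * (x *m A) 0 j).
  by apply: continuousM; exact: c.
by apply/funext => y; rewrite expr2.
Qed.

(** Extreme value theorem on the compact unit sphere, extended to all [y] by homogeneity; [x] is a
    top left singular vector. *)
Lemma exists_max_nsq_mul m n (A : 'M[R]_(m.+1, n)) :
  exists2 x : 'rV[R]_m.+1, nsq x = 1 &
    forall y, nsq (y *m A) <= nsq (x *m A) * nsq y.
Proof.
pose S := [set x : 'rV[R]_m.+1 | nsq x = 1]%classic.
have cnsq : continuous (@nsq m.+1).
  have := @continuous_nsq_mul m.+1 m.+1 1%:M.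
  by under eq_fun do rewrite mulmx1.
have S0 : (S !=set0)%classic.
  exists (delta_mx 0 0); rewrite /S /= /nsq (bigD1 ord0)//= big1 => [|i i0].
    by rewrite mxE !eqxx expr1n addr0.
  by rewrite mxE (negPf i0) andbF expr0n.
have Scl : closed S.
  have := (continuous_closedP _).1 cnsq [set 1]%classic.
  by apply; apply: closed_eq.
(* The norm on matrices is the maximum norm, and each squared coordinate is at most [nsq x = 1]. *)
have Sbd : bounded_set S.
  exists 1; split; first exact: num_real.
  move=> M M1 x Sx; apply: le_trans (ltW M1).
  rewrite [`|x|]mx_normrE; apply: bigmax_le => // -[i j] _ /=.
  rewrite (ord1 i) -(@ler_pXn2r _ 2) ?nnegrE// expr1n -normrX ger0_norm ?sqr_ge0//.
  rewrite -Sx /nsq (bigD1 j)//= lerDl; apply: sumr_ge0 => h _; exact: sqr_ge0.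
have [|x] := @EVT_max_rV _ _ (fun x => nsq (x *m A)) _ S0 (bounded_closed_compact Sbd Scl).
  by apply: continuous_subspaceT; exact: continuous_nsq_mul.
rewrite inE => Sx xmax; exists x => // y.
have [y0|y0] := eqVneq (nsq y) 0.
  by rewrite (nsq_eq0 y0) mul0mx !nsq0 mulr0.
have ygt0 : 0 < nsq y by rewrite lt0r y0 nsq_ge0.
pose c := (Num.sqrt (nsq y))^-1.
have c2 : c ^+ 2 = (nsq y)^-1 by rewrite exprVn sqr_sqrtr// ltW.
have := xmax (c *: y); rewrite inE /S/= nsqZ c2 mulVf// => /(_ erefl).
by rewrite -scalemxAl nsqZ c2 mulrC ler_pdivrMr.
Qed.

(* The Householder reflection exchanging [e_0] and [x]. *)
Lemma orthogonal_completion n (x : 'rV[R]_n.+1) : nsq x = 1 ->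
  exists2 P : 'M[R]_n.+1, P *m P^T = 1%:M & delta_mx 0 0 *m P = x.
Proof.
move=> x1; pose e : 'rV[R]_n.+1 := delta_mx 0 0; rewrite -/e.
have dot (y z : 'rV[R]_n.+1) : y *m z^T = ((y *m z^T) 0 0)%:M.
  by apply/matrixP => i j; rewrite !ord1 [in RHS]mxE mulr1n.
have ee : (e *m e^T) 0 0 = 1.
  by rewrite /e trmx_delta mul_delta_mx mxE.
have ex : (e *m x^T) 0 0 = x 0 0.
  by rewrite /e -rowE !mxE.
have xe : (x *m e^T) 0 0 = x 0 0.
  have -> : x *m e^T = (e *m x^T)^T by rewrite trmx_mul trmxK.
  by rewrite mxE ex.
have subE (B C : 'M[R]_1) : (B - C) 0 0 = B 0 0 - C 0 0 by rewrite !mxE.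
have [v vE] : {v | v = x - e} by exists (x - e).
have vv : nsq v = 2 - 2 * x 0 0.
  rewrite nsqE vE linearB/= mulmxBl !mulmxBr.
  by rewrite !subE ee ex xe -nsqE x1; ring.
have [v0|v0] := eqVneq (nsq v) 0.
  exists 1%:M; first by rewrite trmx1 mulmx1.
  by rewrite mulmx1; apply/esym/eqP; rewrite -subr_eq0 -vE; apply/eqP/nsq_eq0.
(* The reflection along [v] is symmetric and squares to the identity. It sends [e] to [e + v = x]
   because [vv] gives [c * (e *m v^T) 0 0 = -1]. *)
pose c := 2 / nsq v.
exists (1%:M - c *: (v^T *m v)).
  have -> : (1%:M - c *: (v^T *m v))^T = 1%:M - c *: (v^T *m v).
    have : (v^T *m v)^T = v^T *m v by rewrite trmx_mul trmxK.
    move: (v^T *m v) => M /matrixP sym; apply/matrixP => i j.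
    by have := sym i j; rewrite !mxE => ->; rewrite eq_sym.
  rewrite mulmxBl !mulmxBr !mulmx1 !mul1mx -scalemxAl -scalemxAr.
  have -> : v^T *m v *m (v^T *m v) = nsq v *: (v^T *m v).
    rewrite mulmxA -(mulmxA v^T) dot -nsqE -mulmxA mul_scalar_mx.
    by rewrite scalemxAr.
  rewrite /c; move: (v^T *m v) => M; apply/matrixP => i j; rewrite !mxE.
  by field.
rewrite mulmxBr mulmx1 -scalemxAr mulmxA dot mul_scalar_mx scalerA.
have -> : c * (e *m v^T) 0 0 = - 1.
  have -> : (e *m v^T) 0 0 = x 0 0 - 1.
    by rewrite vE linearB/= mulmxBr subE ex ee.
  rewrite /c; apply: (mulIf v0); rewrite mulrAC divfK// vv; ring.
by rewrite scaleN1r opprK vE addrC subrK.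
Qed.

End square_norm.

(** * Singular value decomposition *)

Section singular_value_decomposition.
Variable R : realType.

Lemma orthoC n (P : 'M[R]_n) : P *m P^T = 1%:M -> P^T *m P = 1%:M.
Proof. exact: mulmx1C. Qed.

Lemma ortho_mul n (P Q : 'M[R]_n) :
  P *m P^T = 1%:M -> Q *m Q^T = 1%:M -> (P *m Q) *m (P *m Q)^T = 1%:M.
Proof. by move=> PP QQ; rewrite trmx_mul mulmxA -(mulmxA P) QQ mulmx1. Qed.

Lemma ortho_block n (P : 'M[R]_n) : P *m P^T = 1%:M ->
  block_mx 1%:M 0 0 P *m (block_mx 1%:M 0 0 P)^T = 1%:M :> 'M[R]_(1 + n).
Proof.
move=> PP; rewrite tr_block_mx mulmx_block !trmx0 trmx1 !mulmx0 !mul0mx.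
by rewrite !addr0 !add0r mulmx1 PP -scalar_mx_block.
Qed.

Lemma rdiag_block m n (a : R) s :
  rdiag (1 + m) (1 + n) (fun i => if i is j.+1 then s j else a) =
  block_mx a%:M 0 0 (rdiag m n s).
Proof.
rewrite -[LHS]submxK; congr block_mx; apply/matrixP => i j; rewrite !mxE//=.
all: by rewrite ?ord1.
Qed.

(** Orthogonal changes of basis move the maximizer [x] and the direction [y] of its image to first
    basis vectors. The first row of [B] is then [sg] times a basis vector, and maximality clears the
    first column, leaving the smaller block [D]. *)
Lemma svd_exists m n (A : 'M[R]_(m, n)) : exists s, is_svals A s.
Proof.
have svd0 m' n' (B : 'M[R]_(m', n')) : B = 0 -> exists s, is_svals B s.
  move=> ->; exists (fun=> 0); split=> //; exists 1%:M, 1%:M.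
  rewrite !trmx1 !mulmx1 mul1mx; split=> //; split=> //.
  by apply/matrixP => i j; rewrite !mxE; case: eqP.
elim: m n A => [|m IH] [|n] A; try by apply: svd0; apply/matrixP => -[i ?] [j ?].
have [x x1 xmax] := exists_max_nsq_mul A.
have [xA0|xA0] := eqVneq (nsq (x *m A)) 0.
  apply: svd0; apply/row_matrixP => i; rewrite row0 rowE.
  apply: nsq_eq0; apply/eqP; rewrite eq_le nsq_ge0 andbT.
  by apply: le_trans (xmax _) _; rewrite xA0 mul0r.
have xAgt0 : 0 < nsq (x *m A) by rewrite lt0r xA0 nsq_ge0.
pose sg := Num.sqrt (nsq (x *m A)).
have sg2 : sg ^+ 2 = nsq (x *m A) by rewrite sqr_sqrtr// ltW.
have sg0 : 0 < sg by rewrite sqrtr_gt0.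
pose y := sg^-1 *: (x *m A).
have y1 : nsq y = 1 by rewrite nsqZ exprVn sg2 mulVf.
have xAE : x *m A = sg *: y by rewrite scalerA divff ?gt_eqF// scale1r.
have [P PP eP] := orthogonal_completion x1.
have [Q QQ eQ] := orthogonal_completion y1.
pose B : 'M[R]_(1 + m, 1 + n) := P *m A *m Q^T.
have AE : A = P^T *m B *m Q.
  by rewrite !mulmxA orthoC// mul1mx -mulmxA orthoC// mulmx1.
have Brow : row 0 B = sg *: delta_mx 0 0.
  rewrite rowE /B !mulmxA eP xAE -scalemxAl -eQ -mulmxA QQ mulmx1.
  by [].
have Bmax z : nsq (z *m B) <= sg ^+ 2 * nsq z.
  rewrite /B !mulmxA nsq_mul_isometry ?trmxK ?orthoC// sg2.
  by apply: le_trans (xmax _) _; rewrite (nsq_mul_isometry _ PP).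
pose c := dlsubmx B; pose D := drsubmx B.
have BE : B = block_mx sg%:M 0 c D.
  rewrite -[LHS]submxK; congr block_mx.
    apply/matrixP => i j; rewrite !ord1.
    by have /rowP/(_ 0) := Brow; rewrite !mxE !lshift0 => ->; rewrite mulr1.
  apply/matrixP => i j; rewrite !ord1.
  have /rowP/(_ (rshift 1 j)) := Brow; rewrite !mxE lshift0 => ->.
  by rewrite mulr0.
(* The bound [Bmax] is tested at the row [(sg, c^T)], whose image has first coordinate
   [sg^2 + |c|^2]: this gives [(sg^2 + |c|^2)^2 <= sg^2 (sg^2 + |c|^2)], so [|c|^2 = 0]. *)
have c0 : c = 0.
  suff : nsq c^T = 0 by move/nsq_eq0 => /(congr1 trmx); rewrite trmxK trmx0.
  have := Bmax (row_mx sg%:M c^T).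
  rewrite BE mul_row_block !mulmx0 add0r nsq_row_mx.
  have -> : sg%:M *m sg%:M + c^T *m c = (sg ^+ 2 + nsq c^T)%:M :> 'M[R]_1.
    apply/matrixP => i j; rewrite !ord1 nsqE trmxK mul_scalar_mx.
    by rewrite !mxE !mulr1n expr2.
  rewrite nsq_row_mx.
  have nsq1 (a : R) : nsq (a%:M : 'M[R]_1) = a ^+ 2 by rewrite /nsq big_ord1 mxE.
  rewrite !nsq1; have := nsq_ge0 (c^T *m D); have := nsq_ge0 c^T.
  have : 0 < sg ^+ 2 by rewrite exprn_gt0.
  move: (sg ^+ 2) (nsq c^T) (nsq _) => a b t a0 b0 t0 h.
  nra.
have [s [s0 [P1 [Q1 [PP1 [QQ1 DE]]]]]] := IH n D.
exists (fun i => if i is j.+1 then s j else sg); split.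
  by move=> [_|i]; [exact: ltW|rewrite minnSS ltnS; exact: s0].
exists (P^T *m (block_mx 1%:M 0 0 P1 : 'M[R]_(1 + m))),
  ((block_mx 1%:M 0 0 Q1 : 'M[R]_(1 + n)) *m Q).
split; first by apply: ortho_mul; [rewrite trmxK orthoC|exact: ortho_block].
split; first by apply: ortho_mul => //; exact: ortho_block.
have BD : B = block_mx 1%:M 0 0 P1 *m (rdiag (1 + m) (1 + n)
    (fun i => if i is j.+1 then s j else sg) *m block_mx 1%:M 0 0 Q1).
  rewrite rdiag_block BE c0 DE !mulmx_block !mulmx0 !mul0mx !addr0 !add0r.
  by rewrite mul1mx mulmx1 !mulmxA !mulmx0.
by rewrite [LHS]AE BD !mulmxA.
Qed.

(** A canonical representative: [is_svals] fixes neither the order nor the values from [minn m n]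
    on. Extension by zero lets matrices of different shapes be compared index by index. *)
Definition sorted_svals m n (Y : 'M[R]_(m, n)) (s : nat -> R) :=
  [/\ is_svals Y s, forall i, 0 <= s i, forall i, s i.+1 <= s i &
      forall i, (minn m n <= i)%N -> s i = 0].

(** Sorting permutes the diagonal; the permutation is extended to row and column indices and
    absorbed into the orthogonal factors. *)
Lemma sort_svals m n (Y : 'M[R]_(m, n)) s : is_svals Y s ->
  exists2 t, sorted_svals Y t &
    forall f : R -> R, \sum_(i < minn m n) f (s i) = \sum_(i < minn m n) f (t i).
Proof.
move=> [s0 [P [Q [PP [QQ YE]]]]]; set k := minn m n.
pose u : k.-tuple R := [tuple s i | i < k].
pose v : k.-tuple R := sort_tuple (fun a b => b <= a) u.
have /tuple_permP[p vE] : perm_eq v u by rewrite perm_sort.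
have {}vE (i : 'I_k) : tnth v i = s (p i).
  have -> : v = [tuple tnth u (p i) | i < k] by exact/val_inj.
  by rewrite !tnth_mktuple.
have v_sorted : sorted (fun a b => b <= a) v.
  by apply: sort_sorted => a b; exact: le_total.
pose t i := nth 0 v i.
have tE (i : 'I_k) : t i = s (p i) by rewrite -vE (tnth_nth 0).
have t_out i : (k <= i)%N -> t i = 0 by move=> ki; rewrite /t nth_default ?size_tuple.
have t0 i : 0 <= t i.
  have [/t_out -> //|ik] := leqP k i.
  by have -> := tE (Ordinal ik); apply: s0.
exists t; last first.
  move=> f; rewrite (reindex_inj (@perm_inj _ p)).
  by apply: eq_bigr => i _; rewrite tE.
split=> //; last first.
  move=> i; have [/t_out -> //|ik] := leqP k i.+1.
  by apply/(sortedP 0 v_sorted); rewrite size_tuple.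
split=> [i _//|].
(* The extension of [p] fixes every index from [k] on; [insub] decides on which side of [k] an index
   lies. *)
have ext l : (k <= l)%N -> exists q : 'S_l, forall i : 'I_l,
    if insub (val i) is Some j then val (q i) = val (p j) else q i = i.
  move=> kl.
  pose f (i : 'I_l) := if insub (val i) is Some j then widen_ord kl (p j) else i.
  have finj : injective f.
    move=> i j; rewrite /f.
    case: insubP => [i' _ i'E|ni]; case: insubP => [j' _ j'E|nj].
    - by move=> /(congr1 val)/= /val_inj/perm_inj ij; apply/val_inj; rewrite -i'E -j'E ij.
    - by move=> /(congr1 val)/= e; move: nj; rewrite /= -e ltn_ord.
    - by move=> /(congr1 val)/= e; move: ni; rewrite /= e ltn_ord.
    - by [].
  exists (perm finj) => i; rewrite permE /f.
  by case: insubP.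
have [q qE] := ext m (geq_minl _ _); have [q' q'E] := ext n (geq_minr _ _).
have e : rdiag m n s = row_perm q^-1 (col_perm q'^-1 (rdiag m n t)).
  have -> : rdiag m n t = row_perm q (col_perm q' (rdiag m n s)).
    apply/matrixP => i j; rewrite !mxE.
    have := qE i; have := q'E j.
    case: insubP => [j' _ j'E|nj]; case: insubP => [i' _ i'E|ni].
    - move=> -> ->; rewrite -i'E -j'E tE.
      by rewrite !(inj_eq val_inj) (inj_eq perm_inj).
    - move=> qj qi; rewrite !(ifN, ifN_eq)//.
        by rewrite qi; apply: contra ni => /eqP/= ->; rewrite qj ltn_ord.
      by apply: contra ni => /eqP/= ->; rewrite -j'E ltn_ord.
    - move=> qj qi; rewrite !(ifN, ifN_eq)//.
        by rewrite qj; apply: contra nj => /eqP/= <-; rewrite qi ltn_ord.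
      by apply: contra nj => /eqP/= <-; rewrite -i'E ltn_ord.
    (* Both indices are at least [k = minn m n], so they cannot be equal. *)
    - move=> -> ->; case: eqP => // ij; exfalso.
      move: ni; rewrite leq_min ltn_ord/=; rewrite {1}ij.
      by rewrite ltn_ord.
  by apply/matrixP => i j; rewrite !mxE !permKV.
have ortho_perm l (a : 'S_l) : perm_mx a *m (perm_mx a)^T = 1%:M :> 'M[R]_l.
  by rewrite tr_perm_mx -perm_mxM mulgV perm_mx1.
exists (P *m perm_mx q^-1), (perm_mx q' *m Q); split; first exact: ortho_mul.
split; first exact: ortho_mul.
rewrite YE -/(rdiag m n s) e row_permE col_permE invgK !mulmxA.
by [].
Qed.

Lemma sorted_svals_exists m n (Y : 'M[R]_(m, n)) : exists s, sorted_svals Y s.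
Proof. by have [s /sort_svals[t ? _]] := svd_exists Y; exists t. Qed.

Lemma is_svals_svals m n (Y : 'M[R]_(m, n)) : is_svals Y (svals Y).
Proof. by have [s sP] := svd_exists Y; exact: (xgetI _ sP). Qed.

End singular_value_decomposition.

(** * Horn's inequality *)

Section singular_value_inequalities.
Variable R : realType.

Lemma nsq_mul_rdiag m n (b : 'rV[R]_m) s :
  (forall i, (minn m n <= i)%N -> s i = 0) ->
  nsq (b *m rdiag m n s) = \sum_j b 0 j ^+ 2 * s j ^+ 2.
Proof.
move=> s0; rewrite nsqE trmx_mul tr_rdiag mulmxA -(mulmxA b) mul_rdiag; last first.
  by move=> i ni; rewrite s0 ?mul0r// geq_min ni orbT.
rewrite mxE; apply: eq_bigr => j _; rewrite !mxE (bigD1 j)//= big1 => [|h hj].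
  by rewrite !mxE eqxx addr0; ring.
by rewrite !mxE ifN ?mulr0.
Qed.

(** For [k <= l], [rdiag k l (trunc1 k)] is the inclusion of the first [k] coordinates. *)
Definition trunc1 k (i : nat) : R := (i < k)%:R.

Lemma trunc1_out k i : (k <= i)%N -> trunc1 k i = 0.
Proof. by rewrite /trunc1 ltnNge => ->. Qed.

Lemma rdiag_trunc1_isometry k l : (k <= l)%N ->
  rdiag k l (trunc1 k) *m rdiag l k (trunc1 k) = 1%:M.
Proof.
move=> kl; rewrite mul_rdiag => [|i li]; last first.
  by rewrite trunc1_out ?mul0r// (leq_trans kl).
by rewrite -rdiag1; apply: eq_rdiag => i; rewrite minnn /trunc1 => ->; rewrite mulr1.
Qed.

(* Courant-Fischer: the span of the top [i+1] left singular vectors of [C A E]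
   meets the orthogonal complement of the top [i] left singular vectors of [A]. *)
Lemma svals_compress_le m n k l (A : 'M[R]_(m, n)) (C : 'M[R]_(k, m))
    (E : 'M[R]_(n, l)) s t :
  C *m C^T = 1%:M -> E^T *m E = 1%:M ->
  sorted_svals A s -> sorted_svals (C *m A *m E) t -> forall i, t i <= s i.
Proof.
move=> CC EE [[_ [P [Q [PP [QQ AE]]]]] s0 s_dec s_out].
move=> [[_ [P' [Q' [PP' [QQ' BE]]]]] t0 t_dec t_out] i.
have [/t_out -> //|ikl] := leqP (minn k l) i.
have ik : (i < k)%N by move: ikl; rewrite leq_min => /andP[].
rewrite -/(rdiag m n s) in AE; rewrite -/(rdiag k l t) in BE.
pose J : 'M[R]_(i.+1, k) := rdiag i.+1 k (trunc1 i.+1).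
have JJ : J *m J^T = 1%:M by rewrite tr_rdiag rdiag_trunc1_isometry.
(* The rows of [J *m P'^T] are the top [i+1] left singular vectors of the compression; [N] writes
   their images under [C] in the left singular basis of [A]. *)
pose N := J *m P'^T *m C *m P.
have NN : N *m N^T = 1%:M.
  rewrite /N !trmx_mul trmxK !mulmxA -(mulmxA _ P P^T) PP mulmx1.
  rewrite -(mulmxA _ C C^T) CC mulmx1 -(mulmxA J) orthoC// mulmx1 JJ.
  by [].
(* There are [i+1] unknowns and only [i] linear conditions. *)
have [a aN a0] : exists2 a : 'rV[R]_i.+1,
    (forall j : 'I_m, (j < i)%N -> (a *m N) 0 j = 0) & a != 0.
  pose M := N *m rdiag m i (fun=> 1).
  have : kermx M != 0.
    rewrite kermx_eq0 /row_free; apply/negP => /eqP rM.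
    by have := rank_leq_col M; rewrite rM ltnn.
  move=> /rowV0Pn[a]; rewrite sub_kermx mulmxA => /eqP aM a0; exists a => // j ji.
  have /rowP/(_ (Ordinal ji)) := aM; rewrite [X in _ = X]mxE mxE.
  rewrite (bigD1 j)//= big1 => [|h hj].
    by rewrite [X in _ * X]mxE eqxx mulr1 addr0.
  by rewrite [X in _ * X]mxE ifN ?mulr0.
have agt0 : 0 < nsq a.
  by rewrite lt0r nsq_ge0 andbT; apply: contra_neq a0 => /nsq_eq0.
have lower : t i ^+ 2 * nsq a <= nsq (a *m J *m P'^T *m (C *m A *m E)).
  rewrite BE !mulmxA -(mulmxA _ P'^T P') orthoC// mulmx1.
  rewrite [leRHS]nsq_mul_isometry// nsq_mul_rdiag//.
  rewrite -(nsq_mul_isometry a JJ) mulr_sumr; apply: ler_sum => j _.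
  rewrite mulrC; have [ij|ji] := ltnP i j.
    suff -> : (a *m J) 0 j = 0 by rewrite expr0n !mul0r.
    rewrite mxE big1// => h _; rewrite mxE ifN ?mulr0//.
    by have := ltn_ord h; rewrite ltnS => hi; rewrite ltn_eqF// (leq_ltn_trans hi).
  by rewrite ler_wpM2l ?sqr_ge0// lerXn2r ?nnegrE// nonincreasing_le.
have upper : nsq (a *m J *m P'^T *m (C *m A *m E)) <= s i ^+ 2 * nsq a.
  have -> : a *m J *m P'^T *m (C *m A *m E) = a *m N *m rdiag m n s *m Q *m E.
    by rewrite AE /N !mulmxA.
  apply: le_trans (nsq_mul_contraction _ EE) _.
  rewrite [leLHS]nsq_mul_isometry// nsq_mul_rdiag//.
  rewrite -(nsq_mul_isometry a NN) mulr_sumr; apply: ler_sum => j _.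
  rewrite [leRHS]mulrC; have [ji|ij] := ltnP j i.
    by rewrite aN// expr0n !mul0r.
  by rewrite ler_wpM2l ?sqr_ge0// lerXn2r ?nnegrE// nonincreasing_le.
have := le_trans lower upper; rewrite ler_pM2r//.
by rewrite ler_pXn2r ?nnegrE.
Qed.

Lemma sorted_svals_uniq m n (Y : 'M[R]_(m, n)) s t :
  sorted_svals Y s -> sorted_svals Y t -> forall i, s i = t i.
Proof.
move=> sY tY i; apply/le_anti/andP; split.
- by apply: (@svals_compress_le m n m n Y 1%:M 1%:M) tY _ i;
    rewrite ?trmx1 ?mulmx1 ?mul1mx.
- by apply: (@svals_compress_le m n m n Y 1%:M 1%:M) sY _ i;
    rewrite ?trmx1 ?mulmx1 ?mul1mx.
Qed.

(** Makes the choice inside [svals] harmless: sorting keeps the power sum, and the sorted sequence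
    is unique. *)
Lemma schattenE m n (q : R) (Y : 'M[R]_(m, n)) s : sorted_svals Y s ->
  schatten q Y = (\sum_(i < minn m n) s i `^ q) `^ q^-1.
Proof.
move=> sY; have [t tY tE] := sort_svals (is_svals_svals Y).
rewrite /schatten (tE (fun x => x `^ q)); congr (_ `^ _).
by apply: eq_bigr => i _; rewrite (sorted_svals_uniq tY sY).
Qed.

Lemma sorted_svals_tr m n (Y : 'M[R]_(m, n)) s :
  sorted_svals Y s -> sorted_svals Y^T s.
Proof.
move=> [[h [P [Q [PP [QQ YE]]]]] s0 s_dec s_out]; split=> //; last first.
  by rewrite minnC.
split; first by rewrite minnC.
exists Q^T, P^T; rewrite !trmxK !orthoC//; split=> //; split=> //.
rewrite YE -/(rdiag m n s) -/(rdiag n m s) !trmx_mul tr_rdiag !mulmxA.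
by [].
Qed.

(** * Determinants of compressions *)

Lemma normr_det_ortho n (P : 'M[R]_n) : P *m P^T = 1%:M -> `|\det P| = 1.
Proof.
move=> /(congr1 determinant); rewrite det_mulmx det_tr det1 -expr2 => h.
by apply/eqP; rewrite -sqrp_eq1// -normrX h normr1.
Qed.

(** Stands for a norm bound on every exterior power of [A], tested on orthonormal [k]-frames. *)
Definition det_dominated m n (A : 'M[R]_(m, n)) (a : nat -> R) :=
  forall k (C : 'M[R]_(k, m)) (E : 'M[R]_(n, k)),
    C *m C^T = 1%:M -> E^T *m E = 1%:M ->
    `|\det (C *m A *m E)| <= \prod_(i < k) a i.

Lemma det_dominated_svals m n (A : 'M[R]_(m, n)) s :
  sorted_svals A s -> det_dominated A s.
Proof.
move=> sA k C E CC EE; have [t tB] := sorted_svals_exists (C *m A *m E).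
have ts := svals_compress_le CC EE sA tB.
have [[_ [P [Q [PP [QQ ->]]]]] t0 _ _] := tB.
rewrite -/(rdiag k k t) !det_mulmx !normrM (normr_det_ortho PP) (normr_det_ortho QQ) mul1r mulr1.
rewrite det_rdiag ger0_norm ?prodr_ge0//.
by apply: ler_prod => i _; rewrite t0 ts.
Qed.

(** The first [k] left singular vectors of [Y] serve as the columns of [F]; their span contains the
    range of [Y]. *)
Lemma orthonormal_range d k (Y : 'M[R]_(d, k)) : (k <= d)%N ->
  exists2 F : 'M[R]_(d, k), F^T *m F = 1%:M & F *m (F^T *m Y) = Y.
Proof.
move=> kd; have [s [_ [P [Q [PP [QQ ->]]]]]] := svd_exists Y.
rewrite -/(rdiag d k s).
exists (P *m rdiag d k (trunc1 k)).
  rewrite trmx_mul tr_rdiag mulmxA -(mulmxA _ P^T P) orthoC// mulmx1.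
  exact: rdiag_trunc1_isometry.
rewrite trmx_mul tr_rdiag !mulmxA -(mulmxA _ P^T P) orthoC// mulmx1.
rewrite -(mulmxA P) mul_rdiag => [|i ki]; last by rewrite trunc1_out ?mul0r.
rewrite -(mulmxA P) mul_rdiag => [|i di]; last first.
  by rewrite trunc1_out ?mul0r// (leq_trans kd).
congr (_ *m _ *m _); apply: eq_rdiag => i; rewrite leq_min => /andP[_ ik].
by rewrite /trunc1 ik !mul1r.
Qed.

Lemma det_dominated_mul m d n (A : 'M[R]_(m, d)) (B : 'M[R]_(d, n)) a b :
  (forall i, 0 <= a i) -> (forall i, 0 <= b i) ->
  det_dominated A a -> det_dominated B b ->
  det_dominated (A *m B) (fun i => a i * b i).
Proof.
move=> a0 b0 hA hB k C E CC EE; have [kd|dk] := leqP k d; last first.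
  (* For [d < k] the determinant must vanish: an invertible product would have rank [k] while
     factoring through dimension [d]. *)
  have [->|] := eqVneq (\det (C *m (A *m B) *m E)) 0.
    by rewrite normr0 prodr_ge0// => i _; rewrite mulr_ge0.
  rewrite -unitfE -unitmxE => /mxrank_unit rk.
  have := mxrankM_maxl (C *m A) (B *m E); rewrite mulmxA -!mulmxA in rk *.
  rewrite rk => h; have := leq_trans h (rank_leq_col _).
  by rewrite leqNgt dk.
have [F FF FE] := orthonormal_range (B *m E) kd.
have -> : C *m (A *m B) *m E = (C *m A *m F) *m (F^T *m B *m E).
  by rewrite -!mulmxA FE.
rewrite det_mulmx normrM big_split/=.
apply: ler_pM => //; first exact: hA.
by apply: hB; rewrite ?trmxK.
Qed.

(** Compressing [X] to its top [k] left and right singular vectors gives the diagonal matrix of [x],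
    whose determinant is the left-hand product. *)
Lemma prod_svals_le m n (X : 'M[R]_(m, n)) x a k :
  sorted_svals X x -> det_dominated X a -> (k <= minn m n)%N ->
  \prod_(i < k) x i <= \prod_(i < k) a i.
Proof.
move=> [[_ [P [Q [PP [QQ XE]]]]] x0 _ _] hX; rewrite leq_min => /andP[km kn].
rewrite -/(rdiag m n x) in XE.
have := hX k (rdiag k m (trunc1 k) *m P^T) (Q^T *m rdiag n k (trunc1 k)).
have -> : rdiag k m (trunc1 k) *m P^T *m X *m (Q^T *m rdiag n k (trunc1 k)) = rdiag k k x.
  rewrite XE !mulmxA -(mulmxA _ P^T P) orthoC// mulmx1 -(mulmxA _ Q Q^T) QQ mulmx1.
  rewrite mul_rdiag => [|i mi]; last by rewrite trunc1_out ?mul0r// (leq_trans km).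
  rewrite mul_rdiag => [|i ni]; last by rewrite trunc1_out ?mulr0// (leq_trans kn).
  by apply: eq_rdiag => i; rewrite minnn /trunc1 => ->; rewrite mulr1 mul1r.
rewrite det_rdiag ger0_norm ?prodr_ge0//; apply.
  by rewrite trmx_mul tr_rdiag trmxK mulmxA -(mulmxA _ P^T P) orthoC// mulmx1 rdiag_trunc1_isometry.
by rewrite trmx_mul tr_rdiag trmxK mulmxA -(mulmxA _ Q Q^T) QQ mulmx1 rdiag_trunc1_isometry.
Qed.

(** If [x i] were nonzero, inverting [x 0, ..., x i] would turn [X] into [pid_mx i.+1], forcing rank
    at least [i+1]. *)
Lemma svals_rank m n (X : 'M[R]_(m, n)) x i :
  sorted_svals X x -> (\rank X <= i)%N -> x i = 0.
Proof.
move=> [[_ [P [Q [PP [QQ XE]]]]] x0 x_dec x_out] ri.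
apply/eqP; apply: contraLR ri => xi; rewrite -ltnNge.
have imn : (i < minn m n)%N.
  by rewrite ltnNge; apply: contra xi => /x_out ->.
have [im ein] : (i < m)%N /\ (i < n)%N by apply/andP; rewrite -leq_min.
pose y j : R := if (j <= i)%N then (x j)^-1 else 0.
have pidE : pid_mx i.+1 = (rdiag m m y *m P^T) *m X *m Q^T :> 'M[R]_(m, n).
  rewrite XE -/(rdiag m n x) !mulmxA -(mulmxA _ P^T P) orthoC// mulmx1.
  rewrite -(mulmxA _ Q Q^T) QQ mulmx1 mul_rdiag => [|j mj]; last first.
    by rewrite x_out ?mulr0// geq_min mj.
  apply/matrixP => a b; rewrite !mxE /y ltnS; case: eqP => //= _.
  case: ifP => [ai|_]; last by rewrite mul0r.
  rewrite mulVf// gt_eqF// (lt_le_trans _ (nonincreasing_le x_dec ai))//.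
  by rewrite lt0r xi x0.
rewrite -{1}(@rank_pid_mx R m n i.+1)// pidE.
by apply: leq_trans (mxrankM_maxl _ _) (mxrankM_maxr _ _).
Qed.

End singular_value_inequalities.

(** * Schatten norms *)

Section schatten_factorization.
Variable R : realType.

(** Gives sums for differently shaped matrices a common range; the padding adds nothing, as [0] to a
    positive power is [0]. *)
Lemma sorted_svals_sum m n (Y : 'M[R]_(m, n)) s q N : 0 < q ->
  sorted_svals Y s -> (minn m n <= N)%N ->
  \sum_(i < minn m n) s i `^ q = \sum_(i < N) s i `^ q.
Proof.
move=> q0 [_ _ _ s_out] mnN.
rewrite -!(big_mkord xpredT (fun i => s i `^ q)) [RHS](@big_cat_nat _ _ _ (minn m n))//=.
rewrite [X in _ + X]big_nat [X in _ + X]big1 ?addr0// => i /andP[mni _].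
by rewrite s_out// powR0 ?gt_eqF.
Qed.

Lemma schatten_sum m n (Y : 'M[R]_(m, n)) s q N : 0 < q ->
  sorted_svals Y s -> (minn m n <= N)%N ->
  schatten q Y = (\sum_(i < N) s i `^ q) `^ q^-1.
Proof. by move=> q0 sY mnN; rewrite (schattenE q sY) (sorted_svals_sum q0 sY mnN). Qed.

Lemma schatten_mul3_le m n d (U : 'M[R]_(m, d)) (V : 'M[R]_d) (W : 'M[R]_(n, d))
    (p p1 p2 p3 : R) :
  0 < p -> 0 < p1 -> 0 < p2 -> 0 < p3 -> p1^-1 + p2^-1 + p3^-1 = p^-1 ->
  schatten p (U *m V *m W^T) <= schatten p1 U * schatten p2 V * schatten p3 W.
Proof.
move=> p0 p10 p20 p30 pE; set X := U *m V *m W^T; pose N := (m + n + d)%N.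
have [x xX] := sorted_svals_exists X.
have [u uU] := sorted_svals_exists U.
have [v vV] := sorted_svals_exists V.
have [w wW] := sorted_svals_exists W.
have [_ x0 x_dec _] := xX; have [_ u0 _ _] := uU.
have [_ v0 _ _] := vV; have [_ w0 _ _] := wW.
rewrite (schattenE p xX) (schatten_sum p10 uU (_ : _ <= N)%N); last by rewrite /N; lia.
rewrite (schatten_sum p20 vV (_ : _ <= N)%N); last by rewrite /N; lia.
rewrite (schatten_sum p30 wW (_ : _ <= N)%N); last by rewrite /N; lia.
have dom : det_dominated X (fun i => u i * v i * w i).
  apply: det_dominated_mul => //; last first.
  - exact/det_dominated_svals/sorted_svals_tr.
  - by apply: det_dominated_mul => //; exact: det_dominated_svals.
  - by move=> i; rewrite mulr_ge0.
(* Log-majorization is applied up to [minn m n]; the further terms on the right are nonnegative. *)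
have maj : \sum_(i < minn m n) x i `^ p <= \sum_(i < N) (u i * v i * w i) `^ p.
  apply: (@le_trans _ _ (\sum_(i < minn m n) (u i * v i * w i) `^ p)).
    apply: (@log_majorization_sum R (fun i => x i `^ p)
              (fun i => (u i * v i * w i) `^ p)) => [i|i|i|k kmn].
    - exact: powR_ge0.
    - exact: powR_ge0.
    - by rewrite ge0_ler_powR ?nnegrE ?(ltW p0).
    - have prodE (z : nat -> R) : (forall i, 0 <= z i) ->
          \prod_(i < k) z i `^ p = (\prod_(i < k) z i) `^ p.
        move=> z0; elim: k {kmn} => [|k IH]; first by rewrite !big_ord0 powR1.
        by rewrite !big_ord_recr/= IH powRM// prodr_ge0.
      have uvw0 i : 0 <= u i * v i * w i by rewrite !mulr_ge0.
      rewrite (prodE x)// (prodE (fun i => u i * v i * w i))//.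
      rewrite ge0_ler_powR ?(ltW p0) ?nnegrE ?prodr_ge0//.
      exact: prod_svals_le xX dom kmn.
  have mnN : (minn m n <= N)%N by rewrite /N; lia.
  rewrite -!(big_mkord xpredT (fun i => (u i * v i * w i) `^ p)).
  rewrite [leRHS](@big_cat_nat _ _ _ (minn m n))//= lerDl; apply: sumr_ge0 => i _; exact: powR_ge0.
(* Hölder with weights [p / p1], [p / p2], [p / p3], applied to the powers with exponents [p1],
   [p2], [p3]. *)
have hoel : \sum_(i < N) (u i * v i * w i) `^ p <=
    (\sum_(i < N) u i `^ p1) `^ (p / p1) * (\sum_(i < N) v i `^ p2) `^ (p / p2) *
    (\sum_(i < N) w i `^ p3) `^ (p / p3).
  have sum1 : p / p1 + p / p2 + p / p3 = 1.
    by rewrite -!mulrDr pE divff// gt_eqF.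
  apply: le_trans (@hoelder3 R (p / p1) (p / p2) (p / p3) N (fun i => u i `^ p1)
    (fun i => v i `^ p2) (fun i => w i `^ p3) _ _ _ sum1 _ _ _);
    rewrite ?divr_gt0//; last first.
  - by move=> i; exact: powR_ge0.
  - by move=> i; exact: powR_ge0.
  - by move=> i; exact: powR_ge0.
  rewrite le_eqVlt; apply/orP; left; apply/eqP; apply: eq_bigr => i _.
  rewrite !powRM ?mulr_ge0// -!powRrM ![_ * (p / _)]mulrCA !divff ?gt_eqF//.
  by rewrite !mulr1.
have := le_trans maj hoel => h.
have := @ge0_ler_powR R p^-1 _ _ _ _ _ h; rewrite !nnegrE invr_ge0.
rewrite (ltW p0) !mulr_ge0 ?powR_ge0// sumr_ge0 => [|i _]; last exact: powR_ge0.
move=> /(_ isT isT isT) /le_trans; apply.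
have rootE q (T : R) : (T `^ (p / q)) `^ p^-1 = T `^ q^-1.
  by rewrite -powRrM mulrAC divff ?gt_eqF// mul1r.
move: (\sum_(i < N) u i `^ p1) (\sum_(i < N) v i `^ p2) (\sum_(i < N) w i `^ p3).
move=> A B C; rewrite powRM ?mulr_ge0 ?powR_ge0// powRM ?powR_ge0//.
by rewrite (rootE p1) (rootE p2) (rootE p3).
Qed.

(** Young's inequality with the weights [p / p1], [p / p2], [p / p3] bounds the [p]-th power of the
    product; a [p]-th root follows. *)
Lemma mul3_le_mean (p p1 p2 p3 a b c : R) :
  0 < p -> 0 < p1 -> 0 < p2 -> 0 < p3 -> p1^-1 + p2^-1 + p3^-1 = p^-1 ->
  0 <= a -> 0 <= b -> 0 <= c ->
  a * b * c <= ((a `^ p1 / p1 + b `^ p2 / p2 + c `^ p3 / p3) / (1 / p)) `^ (1 / p).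
Proof.
move=> p0 p10 p20 p30 pE a0 b0 c0; rewrite div1r.
have sum1 : p / p1 + p / p2 + p / p3 = 1 by rewrite -!mulrDr pE divff// gt_eqF.
have -> : a * b * c = (a `^ p * b `^ p * c `^ p) `^ p^-1.
  rewrite -!powRM ?mulr_ge0// -powRrM divff ?gt_eqF// powRr1//.
  by rewrite !mulr_ge0.
apply: ge0_ler_powR.
- by rewrite invr_ge0 ltW.
- by rewrite nnegrE !mulr_ge0 ?powR_ge0.
- rewrite nnegrE invrK mulr_ge0 ?(ltW p0)//.
  by do 2?apply: addr_ge0; rewrite divr_ge0 ?powR_ge0// ltW.
have := young3 (divr_gt0 p0 p10) (divr_gt0 p0 p20) (divr_gt0 p0 p30) sum1
  (powR_ge0 a p1) (powR_ge0 b p2) (powR_ge0 c p3).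
rewrite -!powRrM ![_ * (p / _)]mulrCA !divff ?gt_eqF// !mulr1 => /le_trans; apply.
rewrite le_eqVlt; apply/orP; left; apply/eqP; rewrite invrK; ring.
Qed.

(** One factorization attains all three minima, because each factor norm raised to its own exponent
    is the same number [S]. *)
Lemma schatten_factorization m n d (X : 'M[R]_(m, n)) (p p1 p2 p3 : R) :
  (\rank X <= d)%N ->
  0 < p -> 0 < p1 -> 0 < p2 -> 0 < p3 -> p1^-1 + p2^-1 + p3^-1 = p^-1 ->
  exists2 S : R, 0 <= S & exists (U : 'M[R]_(m, d)) V (W : 'M[R]_(n, d)),
    X = U *m V *m W^T /\
    [/\ schatten p X = S `^ p^-1, schatten p1 U = S `^ p1^-1,
        schatten p2 V = S `^ p2^-1 & schatten p3 W = S `^ p3^-1].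
Proof.
move=> rd p0 p10 p20 p30 pE; pose N := (m + n + d)%N.
have [x xX] := sorted_svals_exists X.
have x_rank i : (d <= i)%N -> x i = 0.
  by move=> di; apply: svals_rank xX _; exact: leq_trans di.
have [[_ [P [Q [PP [QQ XE]]]]] x0 x_dec x_out] := xX.
rewrite -/(rdiag m n x) in XE.
exists (\sum_(i < N) x i `^ p); first by apply: sumr_ge0 => i _; exact: powR_ge0.
pose y q i := x i `^ (p / q).
(* The rank bound enters here: passing through inner dimension [d] loses no singular value. *)
have y_out q i : 0 < q -> (minn (minn m n) d <= i)%N -> y q i = 0.
  move=> q0; rewrite geq_min => /orP[/x_out|/x_rank] xi;
  by rewrite /y xi powR0// gt_eqF// divr_gt0.
have y_svals q a b (P' : 'M[R]_a) : 0 < q -> P' *m P'^T = 1%:M ->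
    (minn (minn m n) d <= minn a b)%N -> sorted_svals (P' *m rdiag a b (y q)) (y q).
  move=> q0 PP' le_ab; split=> [|i|i|i abi].
  - split=> [i _|]; first exact: powR_ge0.
    exists P', 1%:M; rewrite trmx1 !mulmx1; split=> //.
  - exact: powR_ge0.
  - by rewrite ge0_ler_powR ?nnegrE// divr_ge0// ltW.
  - by apply: y_out => //; exact: leq_trans abi.
have y_schatten q a b (P' : 'M[R]_a) : 0 < q -> P' *m P'^T = 1%:M ->
    (minn (minn m n) d <= minn a b <= N)%N ->
    schatten q (P' *m rdiag a b (y q)) = (\sum_(i < N) x i `^ p) `^ q^-1.
  move=> q0 PP' /andP[le_ab abN].
  rewrite (schatten_sum q0 (y_svals _ _ _ _ q0 PP' le_ab) abN); congr (_ `^ _).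
  by apply: eq_bigr => i _; rewrite /y -powRrM divfK// gt_eqF.
(* The identity factor gives [V] the shape that [y_schatten] expects. *)
exists (P *m rdiag m d (y p1)), (1%:M *m rdiag d d (y p2)), (Q^T *m rdiag n d (y p3)).
split; last first.
  split.
  - by apply: schatten_sum xX _; rewrite // /N; lia.
  - by apply: y_schatten => //; rewrite /N; lia.
  - by apply: y_schatten; rewrite ?trmx1 ?mulmx1 // /N; lia.
  - by apply: y_schatten; rewrite ?trmxK ?orthoC // /N; lia.
rewrite trmx_mul trmxK tr_rdiag mul1mx !mulmxA.
rewrite -(mulmxA P) mul_rdiag => [|i di]; last first.
  by rewrite y_out ?mul0r// geq_min di orbT.
rewrite -(mulmxA P) mul_rdiag => [|i di]; last first.
  by rewrite y_out ?mul0r// geq_min di orbT.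
rewrite XE; congr (_ *m _ *m _); apply: eq_rdiag => i _.
have sum1 : p / p1 + p / p2 + p / p3 = 1 by rewrite -!mulrDr pE divff// gt_eqF.
rewrite /y -!powRD ?sum1 ?oner_eq0//; first by rewrite powRr1.
by rewrite gt_eqF// addr_gt0// divr_gt0.
Qed.

End schatten_factorization.

Theorem theorem4 (R : realType) (m n d r : nat) (X : 'M[R]_(m, n))
  (p p1 p2 p3 : R) :
  \rank X = r -> (r <= d)%N ->
  0 < p -> p <= 1 -> 0 < p1 -> 0 < p2 -> 0 < p3 ->
  p1^-1 + p2^-1 + p3^-1 = p^-1 ->
  factor_min (d := d) X
    (fun U V W => schatten p1 U * schatten p2 V * schatten p3 W) (schatten p X) /\
  factor_min (d := d) X
    (fun U V W =>
       ((p2 * p3 * (schatten p1 U) `^ p1 + p1 * p3 * (schatten p2 V) `^ p2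
         + p1 * p2 * (schatten p3 W) `^ p3) / (p2 * p3 + p1 * p3 + p1 * p2))
       `^ (1 / p)) (schatten p X) /\
  factor_min (d := d) X
    (fun U V W =>
       (((schatten p1 U) `^ p1 / p1 + (schatten p2 V) `^ p2 / p2
         + (schatten p3 W) `^ p3 / p3) / (1 / p)) `^ (1 / p)) (schatten p X).
Proof.
move=> rX rd p0 _ p10 p20 p30 pE; rewrite -rX in rd.
have [S S0 [U [V [W [XE [SX SU SV SW]]]]]] :=
  schatten_factorization rd p0 p10 p20 p30 pE.
have lower (U' : 'M[R]_(m, d)) (V' : 'M[R]_d) (W' : 'M[R]_(n, d)) : X = U' *m V' *m W'^T ->
    schatten p X <= schatten p1 U' * schatten p2 V' * schatten p3 W'.
  by move=> ->; exact: schatten_mul3_le.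
have powK q : 0 < q -> (S `^ q^-1) `^ q = S.
  by move=> q0; rewrite -powRrM mulVf ?gt_eqF// powRr1.
(* Dividing numerator and denominator by [p1 * p2 * p3] identifies the two means, so the second
   minimum follows from the third. *)
have meanE (a b c : R) : (p2 * p3 * a + p1 * p3 * b + p1 * p2 * c) /
    (p2 * p3 + p1 * p3 + p1 * p2) = (a / p1 + b / p2 + c / p3) / (1 / p).
  rewrite div1r -pE; field.
  by rewrite !lt0r_neq0 ?(mulr_gt0, addr_gt0).
have mean : factor_min (d := d) X
    (fun U V W =>
       (((schatten p1 U) `^ p1 / p1 + (schatten p2 V) `^ p2 / p2
         + (schatten p3 W) `^ p3 / p3) / (1 / p)) `^ (1 / p)) (schatten p X).
  split=> [|U' V' W' XE'].
    exists U, V, W; split=> //; rewrite SX SU SV SW !powK// -!mulrDr pE div1r.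
    by rewrite mulfK// invr_eq0 gt_eqF.
  by apply: le_trans (lower _ _ _ XE') (mul3_le_mean _ _ _ _ _ _ _ _);
    rewrite ?powR_ge0.
split; [split=> // | split=> //].
- exists U, V, W; split=> //; rewrite SX SU SV SW -!powRD ?pE//.
    by rewrite invr_eq0 gt_eqF.
  by rewrite gt_eqF// addr_gt0// invr_gt0.
- have [[U' [V' [W' [XE' fE]]]] fle] := mean.
  split=> [|U'' V'' W'' XE'']; first by exists U', V', W'; rewrite meanE.
  by rewrite meanE; exact: fle.
Qed.
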